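(* Let $J^1_f(\mathbb{R};\mathrm{G}_n)$ be the space of one-jets of fanning curves in the Grassmannian $\mathrm{G}_n$ of $n$-dimensional subspaces of $\mathbb{R}^{2n}$, with its natural action of $\mathrm{GL}(2n)$, let $\mathrm{GL}(2n)$ act on the Lie algebra $\mathfrak{gl}(2n)$ of real $2n\times 2n$ matrices by conjugation, and let $\mathbf{F}: J^1_f(\mathbb{R};\mathrm{G}_n)\to\mathfrak{gl}(2n)$ be the fundamental endomorphism. A map $\mathbf{G}: J^1_f(\mathbb{R};\mathrm{G}_n)\to \mathfrak{gl}(2n)$ is $\mathrm{GL}(2n)$-equivariant if and only if there exist real numbers $a$ and $b$ such that $\mathbf{G} = a\mathbf{F} + b\mathbf{I}$, where $\mathbf{I}$ is the $2n\times 2n$ identity matrix.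
   Context: For $2n\times n$ matrices $\mathcal{A},\mathcal{B}$, $(\mathcal{A}|\mathcal{B})$ denotes the $2n\times 2n$ matrix obtained by juxtaposition. A fanning frame is a smooth curve $\mathcal{A}(t)$ of real $2n\times n$ matrices such that $(\mathcal{A}(t)|\dot{\mathcal{A}}(t))$ is invertible for all $t$; a fanning curve in $\mathrm{G}_n$ is a smooth curve of the form $\ell(t)=$ column span of $\mathcal{A}(t)$ with $\mathcal{A}(t)$ a fanning frame. The space of one-jets of fanning frames is the set of ordered pairs $(\mathcal{A},\dot{\mathcal{A}})$ of $2n\times n$ matrices such that $(\mathcal{A}|\dot{\mathcal{A}})$ is invertible. The group $J^1(\mathbb{R};\mathrm{GL}(n))$ of pairs $(X,\dot X)$ of $n\times n$ matrices with $X$ invertible acts on it on the right by $(\mathcal{A},\dot{\mathcal{A}})\cdot(X,\dot X) = (\mathcal{A}X,\dot{\mathcal{A}}X+\mathcal{A}\dot X)$. The space $J^1_f(\mathbb{R};\mathrm{G}_n)$ of one-jets of fanning curves is the quotient by this action; its elements are written $[(\mathcal{A},\dot{\mathcal{A}})]$, and $\mathrm{GL}(2n)$ acts by $\mathbf{T}\cdot[(\mathcal{A},\dot{\mathcal{A}})] = [(\mathbf{T}\mathcal{A},\mathbf{T}\dot{\mathcal{A}})]$. A map $\mathbf{G}$ is equivariant if $\mathbf{G}(\mathbf{T}\cdot j)=\mathbf{T}\mathbf{G}(j)\mathbf{T}^{-1}$ for all $\mathbf{T}\in \mathrm{GL}(2n)$ and all $j\in J^1_f(\mathbb{R};\mathrm{G}_n)$.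 The fundamental endomorphism is the (well-defined) map $$\mathbf{F}([(\mathcal{A},\dot{\mathcal{A}})]) = (\mathcal{A}|\dot{\mathcal{A}})\begin{pmatrix} O & I\\ O& O\end{pmatrix}(\mathcal{A}|\dot{\mathcal{A}})^{-1},$$ with $n\times n$ blocks; equivalently $\mathbf{F}\mathcal{A}=O$ and $\mathbf{F}\dot{\mathcal{A}}=\mathcal{A}$. *)

(* Defs.v *)
From HB Require Import structures.
From mathcomp Require Import all_boot all_order all_algebra.
From mathcomp Require Import boolp reals.

Set Implicit Arguments.
Unset Strict Implicit.
Unset Printing Implicit Defensive.

Import GRing.Theory.
Local Open Scope ring_scope.
Local Open Scope quotient_scope.

(* [{'GL_m[R]}] of the library is restricted to finite rings. *)
Definition GLgrp (R : realType) (m : nat) := {T : 'M[R]_m | T \in unitmx}.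

Section OneJets.
Variables (R : realType) (n : nat).

Definition frame_jet :=
  {p : 'M[R]_(n + n, n) * 'M[R]_(n + n, n) | row_mx p.1 p.2 \in unitmx}.

Definition jet_GL := {g : 'M[R]_n * 'M[R]_n | g.1 \in unitmx}.

Lemma frame_jet_reparam_subproof (p : frame_jet) (g : jet_GL) :
  let A := (val p).1 in let dA := (val p).2 in
  let X := (val g).1 in let dX := (val g).2 in
  row_mx (A *m X) (dA *m X + A *m dX) \in unitmx.
Proof.
case: p g => -[A dA] /= pu [[X dX] /= Xu].
have -> : row_mx (A *m X) (dA *m X + A *m dX)
          = row_mx A dA *m block_mx X dX 0 X.
  by rewrite mul_row_block mulmx0 addr0 addrC.
by rewrite unitmx_mul pu unitmxE det_ublock unitrM -!unitmxE Xu.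
Qed.

Definition frame_jet_reparam (p : frame_jet) (g : jet_GL) : frame_jet :=
  let A := (val p).1 in let dA := (val p).2 in
  let X := (val g).1 in let dX := (val g).2 in
  exist _ (A *m X, dA *m X + A *m dX) (frame_jet_reparam_subproof p g).

(* [EquivRel] needs a boolean relation, hence the classical [`[< _ >]]. *)
Definition same_jet (p q : frame_jet) : bool :=
  `[< exists g : jet_GL, q = frame_jet_reparam p g >].

Lemma same_jet_refl : reflexive same_jet.
Proof.
move=> p; apply/asboolP.
have u1 : ((1%:M, 0) : 'M[R]_n * 'M[R]_n).1 \in unitmx by rewrite unitmx1.
exists (exist _ (1%:M, 0) u1); apply: val_inj => /=.
by rewrite !mulmx1 mulmx0 addr0 -surjective_pairing.
Qed.

Lemma same_jet_sym : symmetric same_jet.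
Proof.
suff H p q : same_jet p q -> same_jet q p by move=> p q; apply/idP/idP; apply: H.
move=> /asboolP[[[X dX] /= Xu] ->]; apply/asboolP.
have Yu : ((invmx X, - (invmx X *m dX *m invmx X)) : 'M[R]_n * 'M[R]_n).1
          \in unitmx by rewrite unitmx_inv.
exists (exist _ (_, _) Yu); apply: val_inj; case: p => -[A dA] /= _.
congr pair; first by rewrite mulmxK.
by rewrite mulmxDl mulmxK // mulmxN !mulmxA mulmxK // addrK.
Qed.

Lemma same_jet_trans : transitive same_jet.
Proof.
move=> q p r /asboolP[[[X dX] /= Xu] ->] /asboolP[[[Y dY] /= Yu] ->].
apply/asboolP.
have XYu : ((X *m Y, dX *m Y + X *m dY) : 'M[R]_n * 'M[R]_n).1 \in unitmx.
  by rewrite unitmx_mul Xu.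
exists (exist _ (_, _) XYu); apply: val_inj; case: p => -[A dA] /= _.
by rewrite mulmxDl mulmxDr !mulmxA addrA.
Qed.

Canonical same_jet_equiv :=
  EquivRel same_jet same_jet_refl same_jet_sym same_jet_trans.

Definition fanning_jet := {eq_quot same_jet_equiv}.

Definition jet_class (p : frame_jet) : fanning_jet := \pi_fanning_jet p.

Lemma jet_classP (p q : frame_jet) :
  jet_class p = jet_class q <-> exists g : jet_GL, q = frame_jet_reparam p g.
Proof.
by split=> [/eqmodP/asboolP|gP] //; apply/eqmodP/asboolP.
Qed.

Lemma frame_jet_act_subproof (T : GLgrp R (n + n)) (p : frame_jet) :
  row_mx (val T *m (val p).1) (val T *m (val p).2) \in unitmx.
Proof. by rewrite -mul_mx_row unitmx_mul (valP T) (valP p). Qed.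

Definition frame_jet_act (T : GLgrp R (n + n)) (p : frame_jet) : frame_jet :=
  exist _ (val T *m (val p).1, val T *m (val p).2) (frame_jet_act_subproof T p).

(* The two maps out of the quotient below are defined on a canonical
   representative; [fanning_jet_actE] and [fundamental_endoE] show that they do
   not depend on it. *)
Definition fanning_jet_act (T : GLgrp R (n + n)) (j : fanning_jet) :
  fanning_jet := jet_class (frame_jet_act T (repr j)).

Lemma jet_class_repr (p : frame_jet) :
  exists g : jet_GL, repr (jet_class p) = frame_jet_reparam p g.
Proof. by apply/jet_classP; rewrite /jet_class reprK. Qed.

Lemma fanning_jet_actE (T : GLgrp R (n + n)) (p : frame_jet) :
  fanning_jet_act T (jet_class p) = jet_class (frame_jet_act T p).
Proof.
rewrite /fanning_jet_act; have [g ->] := jet_class_repr p.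
apply/esym/jet_classP; exists g; apply: val_inj => /=.
by rewrite mulmxDr !mulmxA.
Qed.

Definition frame_endo (p : frame_jet) : 'M[R]_(n + n) :=
  let P := row_mx (val p).1 (val p).2 in
  P *m block_mx 0 1%:M 0 0 *m invmx P.

Definition fundamental_endo (j : fanning_jet) : 'M[R]_(n + n) :=
  frame_endo (repr j).

Lemma fundamental_endoE (p : frame_jet) :
  fundamental_endo (jet_class p) = frame_endo p.
Proof.
rewrite /fundamental_endo; have [g ->] := jet_class_repr p.
have qu := valP (frame_jet_reparam p g).
rewrite /frame_endo; set Q := row_mx (val (frame_jet_reparam p g)).1 _.
set P := row_mx (val p).1 _; set N := block_mx _ _ _ _.
have Pu : P \in unitmx := valP p.
pose B : 'M[R]_(n + n) := block_mx (val g).1 (val g).2 0 (val g).1.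
have QE : Q = P *m B by rewrite /Q /P mul_row_block mulmx0 addr0 addrC.
have BN : B *m N = N *m B.
  by rewrite /B /N !mulmx_block !(mulmx0, mul0mx, mulmx1, mul1mx, addr0, add0r).
apply: (can_inj (mulmxK qu)); rewrite mulmxKV //.
by rewrite -[row_mx _ _]/Q QE !mulmxA mulmxKV // -!mulmxA BN.
Qed.

Definition equivariant (G : fanning_jet -> 'M[R]_(n + n)) : Prop :=
  forall (T : GLgrp R (n + n)) (j : fanning_jet),
    G (fanning_jet_act T j) = val T *m G j *m invmx (val T).

End OneJets.

(* Main.v *)
Require Import Defs.
From mathcomp Require Import all_boot all_order all_algebra.
From mathcomp Require Import boolp reals.

Set Implicit Arguments.
Unset Strict Implicit.
Unset Printing Implicit Defensive.

Import GRing.Theory.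
Local Open Scope ring_scope.

(** A frame with invertible P = (A|dA) is the translate by P of the standard
    frame, whose matrix is the identity; so GL(2n) acts transitively on jets and
    an equivariant G is determined by its value M at the standard jet. The
    stabilizer of that jet contains the matrices [[X, Y], [0, X]] with X
    invertible, hence M commutes with all of them, and this forces
    M = a [[0, I], [0, 0]] + b I. *)

(** Entry (0, k) of E_0j M = M E_0j reads M_jk = M_00 [j = k]. Size 0 is split off so that the index
    0 exists. *)
Lemma comm_delta_mx_scalar (R : pzRingType) (n : nat) (M : 'M[R]_n) :
  (forall i j, delta_mx i j *m M = M *m delta_mx i j) ->
  exists a, M = a%:M.
Proof.
case: n M => [|n] M cM; first by exists 0; apply/matrixP=> -[].
exists (M 0 0); apply/matrixP=> j k; rewrite !mxE.
have /matrixP/(_ 0 k) := cM 0 j; rewrite !mxE.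
rewrite (bigD1 j) //= big1 => [|l /negPf lj]; last first.
  by rewrite !mxE lj andbF mul0r.
rewrite (bigD1 0) //= big1 => [|l /negPf l0]; last by rewrite !mxE l0 mulr0.
by rewrite !mxE !eqxx mul1r !addr0 mulr_natr eq_sym.
Qed.

Lemma unitmx_add1_delta (R : numFieldType) (n : nat) (i j : 'I_n) :
  1%:M + delta_mx i j \in @unitmx R n.
Proof.
(* Since E_ij^2 = [i = j] E_ij, the inverse is 1 - c E_ij. The inverted scalar is 1 or 2, nonzero in
   characteristic 0. *)
pose c : R := (1 + (i == j)%:R)^-1.
suff /mulmx1_unit[] : (1%:M + delta_mx i j) *m (1%:M - c *: delta_mx i j)
                      = 1%:M :> 'M[R]_n by [].
rewrite mulmxBr mulmx1 -scalemxAr mulmxDl mul1mx.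
have -> : delta_mx i j *m delta_mx i j = (i == j)%:R *: delta_mx i j :> 'M[R]_n.
  case: (eqVneq i j) => [->|ij]; first by rewrite mul_delta_mx scale1r.
  by rewrite mul_delta_mx_0 ?scale0r // eq_sym.
rewrite -[X in _ *: (X + _)]scale1r -scalerDl scalerA mulVf ?scale1r ?addrK //.
by rewrite nat1r Num.Theory.pnatr_eq0.
Qed.

Lemma comm_unitmx_scalar (R : numFieldType) (n : nat) (M : 'M[R]_n) :
  (forall X, X \in unitmx -> X *m M = M *m X) -> exists a, M = a%:M.
Proof.
move=> cM; apply: comm_delta_mx_scalar => i j.
(* The identity summand cancels, leaving commutation with E_ij itself. *)
have := cM _ (unitmx_add1_delta R i j).
by rewrite mulmxDl mulmxDr mul1mx mulmx1 => /addrI.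
Qed.

Lemma comm_jet_block_mx (R : numFieldType) (n : nat) (M : 'M[R]_(n + n)) :
  (forall X Y : 'M[R]_n, X \in unitmx ->
     block_mx X Y 0 X *m M = M *m block_mx X Y 0 X) ->
  exists a b : R, M = a *: block_mx 0 1%:M 0 0 + b *: 1%:M.
Proof.
rewrite -[M]submxK; set A := ulsubmx M; set B := ursubmx M.
set C := dlsubmx M; set D := drsubmx M => cM.
have cM_ X Y : X \in unitmx ->
    X *m A + Y *m C = A *m X /\ X *m B + Y *m D = A *m Y + B *m X.
  move=> /cM - /(_ Y); rewrite !mulmx_block !mul0mx !mulmx0 !addr0 !add0r.
  by move=> /eq_block_mx[].
(* X = Y = 1 gives A + C = A in the upper left block and B + D = A + B in the upper right one. *)
have C0 : C = 0.
  have [+ _] := cM_ 1%:M 1%:M (unitmx1 _ _).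
  by rewrite !mul1mx mulmx1 => /(canRL (addKr _)); rewrite addNr.
have AD : D = A.
  have [_ +] := cM_ 1%:M 1%:M (unitmx1 _ _).
  by rewrite !mul1mx !mulmx1 addrC => /addIr.
(* With Y = 0, both A and B commute with every invertible X. *)
have [b Ab] : exists b, A = b%:M.
  apply: comm_unitmx_scalar => X /cM_ - /(_ 0)[+ _].
  by rewrite mul0mx addr0.
have [a Ba] : exists a, B = a%:M.
  apply: comm_unitmx_scalar => X /cM_ - /(_ 0)[_ +].
  by rewrite mul0mx mulmx0 addr0 add0r.
exists a, b; rewrite C0 AD Ab Ba (scalar_mx_block n n 1).
rewrite !scale_block_mx add_block_mx !scaler0 !addr0 !add0r.
by rewrite !scale_scalar_mx !mulr1.
Qed.

Lemma jet_class_reprK (R : realType) (n : nat) (j : fanning_jet R n) :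
  jet_class (repr j) = j.
Proof. by rewrite /jet_class reprK. Qed.

Section StandardJet.
Variables (R : realType) (n : nat).

Let A0 : 'M[R]_(n + n, n) := col_mx 1%:M 0.
Let dA0 : 'M[R]_(n + n, n) := col_mx 0 1%:M.

Lemma row_mx_standard : row_mx A0 dA0 = 1%:M.
Proof. by rewrite /A0 /dA0 -block_mxEh -scalar_mx_block. Qed.

Lemma standard_frame_unit : row_mx (A0, dA0).1 (A0, dA0).2 \in unitmx.
Proof. by rewrite row_mx_standard unitmx1. Qed.

Definition standard_frame : frame_jet R n :=
  exist _ (A0, dA0) standard_frame_unit.

Definition frame_GL (p : frame_jet R n) : GLgrp R (n + n) :=
  exist _ (row_mx (val p).1 (val p).2) (valP p).

Lemma frame_jet_act_standard (p : frame_jet R n) :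
  frame_jet_act (frame_GL p) standard_frame = p.
Proof.
apply: val_inj; case: p => -[A dA] /= _.
by rewrite /A0 /dA0 !mul_row_col !mulmx0 !mulmx1 addr0 add0r.
Qed.

(** T A0 = A0 X and T dA0 = dA0 X + A0 Y, which is the reparametrization of the standard frame by
    (X, Y). *)
Lemma jet_block_fix_standard (X Y : 'M[R]_n) (T : GLgrp R (n + n)) :
  X \in unitmx -> val T = block_mx X Y 0 X ->
  fanning_jet_act T (jet_class standard_frame) = jet_class standard_frame.
Proof.
move=> Xu TE; rewrite fanning_jet_actE; apply/esym/jet_classP.
exists (exist (fun g => g.1 \in unitmx) (X, Y) Xu); apply: val_inj => /=.
rewrite TE /A0 /dA0 !mul_block_col !mul_col_mx add_col_mx.
by rewrite !mulmx0 !mulmx1 !mul0mx !mul1mx !addr0 !add0r.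
Qed.

End StandardJet.

Theorem theorem1p2 (R : realType) (n : nat)
    (G : fanning_jet R n -> 'M[R]_(n + n)) :
  equivariant G <->
  exists a b : R, forall j : fanning_jet R n,
    G j = a *: fundamental_endo j + b *: 1%:M.
Proof.
split=> [eqG|[a [b GE]] T j].
  have [X Y Xu|a [b Mab]] :=
      @comm_jet_block_mx _ _ (G (jet_class (standard_frame R n))).
    have Bu : block_mx X Y 0 X \in unitmx.
      by rewrite unitmxE det_ublock unitrM -!unitmxE Xu.
    pose T : GLgrp R (n + n) := exist _ (block_mx X Y 0 X) Bu.
    have := eqG T (jet_class (standard_frame R n)).
    by rewrite (@jet_block_fix_standard _ _ X Y) // => {2}->; rewrite mulmxKV.
  exists a, b => j; rewrite -(jet_class_reprK j).
  (* With P the matrix of the representative, equivariance gives G j = P M P^-1. Conjugating M = a N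
     + b by P turns N into the fundamental endomorphism and fixes b. *)
  rewrite fundamental_endoE -{1}(frame_jet_act_standard (repr j)).
  rewrite -fanning_jet_actE eqG Mab /frame_endo /=.
  rewrite mulmxDr mulmxDl -!scalemxAr -!scalemxAl mulmx1 mulmxV //.
  exact: (valP (repr j)).
(* Conjugation fixes the scalar term, so only the equivariance of [fundamental_endo] remains. *)
rewrite !GE mulmxDr mulmxDl -!scalemxAr -!scalemxAl mulmx1 mulmxV ?(valP T) //.
congr (_ *: _ + _); rewrite -(jet_class_reprK j).
rewrite fanning_jet_actE !fundamental_endoE /frame_endo /= -mul_mx_row.
set P := row_mx _ _; have Pu : P \in unitmx := valP (repr j).
have Tu : val T \in unitmx := valP T.
have TPu : val T *m P \in unitmx by rewrite unitmx_mul Tu.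
(* Multiplying on the right by T P clears all the inverses. *)
apply: (can_inj (mulmxK TPu)).
by rewrite mulmxKV // !mulmxA !mulmxKV.
Qed.
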